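(* Let $p \geq 3$ be a fixed integer. Then there is a sequence of edge-colorings $\chi_n$ of the complete graphs $K_n$ ($n = 1,2,\dots$) such that: (i) $\chi_n$ uses at most $n^{o(1)}$ colors (as $n \to \infty$, with $p$ fixed); (ii) $\chi_n$ is a $(p,p-1)$-coloring, i.e. every $p$-clique of $K_n$ contains edges of at least $p-1$ distinct colors; (iii) every $p$-clique of $K_n$ whose edges receive exactly $p-1$ distinct colors under $\chi_n$ is isomorphic, as an edge-colored graph, to an edge-colored $p$-clique with a leftover structure; equivalently, its vertex set has a leftover structure under $\chi_n$.
   Context: For an edge-coloring $f: E(K_n)\to C$ and a vertex set $A$, write $f(A)$ for the set of colors appearing on edges with both endpoints in $A$. A subset $S \subseteq V(K_n)$ has a leftover structure under $f$ if either $|S|=1$, or there is a partition $S = A \cup B$ into nonempty sets $A$, $B$ such that: $A$ and $B$ each have a leftover structure under $f$; $f(A) \cap f(B) = \emptyset$; and there is a color $\alpha \in C$ with $f(a,b) = \alpha$ for all $a \in A$, $b \in B$, and $\alpha \notin f(A)$, $\alpha \notin f(B)$. (Equivalently, a leftover $p$-clique is obtained from a leftover $(p-1)$-clique by duplicating a vertex $x$ into $x,x'$, giving $xx'$ a new color and giving each $x'y$ the color of $xy$.) A $(p,q)$-coloring of a graph is an edge-coloring in which every $p$-clique receives at least $q$ distinct colors. *)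

(* Defs.v *)
From mathcomp Require Import all_boot.
Set Implicit Arguments. Unset Strict Implicit. Unset Printing Implicit Defensive.

(* An edge-coloring of K_n is encoded as a symmetric function
   f : 'I_n -> 'I_n -> nat (colors are naturals); only values f x y with
   x != y matter (the diagonal is ignored). *)
Definition edge_coloring (n : nat) := 'I_n -> 'I_n -> nat.

Definition symmetric_coloring n (f : edge_coloring n) : Prop :=
  forall x y, f x y = f y x.

Definition colors_in n (f : edge_coloring n) (A : {set 'I_n}) : seq nat :=
  undup [seq f e.1 e.2 | e <- enum [pred e : 'I_n * 'I_n |
                                      [&& e.1 \in A, e.2 \in A & e.1 != e.2]]].

Definition ncolors n (f : edge_coloring n) (A : {set 'I_n}) : nat :=
  size (colors_in f A).

Inductive leftover n (f : edge_coloring n) : {set 'I_n} -> Prop :=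
| leftover_single (x : 'I_n) : leftover f [set x]
| leftover_split (A B : {set 'I_n}) (alpha : nat) :
    A != set0 -> B != set0 -> [disjoint A & B] ->
    leftover f A -> leftover f B ->
    (forall c, c \in colors_in f A -> c \notin colors_in f B) ->
    (forall a b, a \in A -> b \in B -> f a b = alpha) ->
    alpha \notin colors_in f A -> alpha \notin colors_in f B ->
    leftover f (A :|: B).

(* Main.v *)
(** Vertices are bit strings of length [b ^ D], with [b] a power of two and [D]
    depending on [p] only. For each [d < D] the string is cut into blocks of
    [b ^ d.+1] bits, each made of [b] digits of [b ^ d] bits; the colour of a pair
    records, for every block of every level, the leading digit where the two
    vertices differ. A level costs about [m * b ^ D.-1] bits for [b = 2 ^ m],
    negligible against [b ^ D].

    Let [S] be a clique of size at most [p] and [q] the lowest bit at which two of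
    its vertices branch. As [d] grows, the number of prefixes of [S] above the
    block of [q] decreases and the number of contents of that block increases, so
    both are stable between some levels [d] and [d.+1]. Let [t] erase the bits
    below the top of the larger block and let [a] read the smaller block: then
    [(t, a)] is injective on [S], and within a fibre of [t] a colour determines the
    values of [a] at its ends. Truncation induces a map on colours, so induction
    applies to [t @: S] and to the sets [V e] of fibres where a given pair [e] of
    values of [a] occurs. The three families of colours - one per pair [e], those
    joining two fibres of some [V e] with record [e], and those of [t @: S] - are
    disjoint and number at least [#|S|.-1]. Equality forces each [V e] to be a
    point and each fibre to have at most two, whence [S] is a blow-up of the
    leftover clique [t @: S]. *)

Require Import Defs.
From mathcomp Require Import all_boot.
From mathcomp Require Import zify.
Set Implicit Arguments. Unset Strict Implicit. Unset Printing Implicit Defensive.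

(** * Colour sets of cliques and blow-ups of leftover structures *)

Lemma uniq_map_inj_in (T1 T2 : eqType) (h : T1 -> T2) (s : seq T1) :
  uniq (map h s) -> {in s &, injective h}.
Proof.
elim: s => //= z s IH /andP[zs us] x y; rewrite !inE.
move=> /predU1P[->|xs] /predU1P[->|ys] // E; last exact: IH.
- by case/mapP: zs; exists y.
- by case/mapP: zs; exists x.
Qed.

Section Colors.
Context {n : nat} (f : edge_coloring n).

Lemma colors_inP (S : {set 'I_n}) c :
  reflect (exists x y, [/\ x \in S, y \in S, x != y & f x y = c])
          (c \in colors_in f S).
Proof.
rewrite /colors_in mem_undup; apply: (iffP mapP) => [[[x y]]|[x [y [xS yS xy <-]]]].
  by rewrite mem_enum inE /= => /and3P[xS yS xy] ->; exists x, y.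
by exists (x, y); rewrite // mem_enum inE /= xS yS.
Qed.

Lemma ncolors_ge (T : eqType) (P : nat -> T) (S : {set 'I_n}) (W : seq T) :
    uniq W -> {subset W <= map P (colors_in f S)} ->
  size W <= ncolors f S.
Proof. by move=> uW sW; rewrite /ncolors -(size_map P); apply: uniq_leq_size. Qed.

Lemma ncolors_tight (T : eqType) (P : nat -> T) (S : {set 'I_n}) (W : seq T) :
    uniq W -> {subset W <= map P (colors_in f S)} -> ncolors f S <= size W ->
  {in colors_in f S &, injective P}.
Proof.
move=> uW sW le_W; have uP : uniq (map P (colors_in f S)).
  by apply: leq_size_uniq uW sW _; rewrite size_map.
exact: uniq_map_inj_in.
Qed.

Hypothesis f_sym : symmetric_coloring f.

(** Induction on the derivation for [T]: a point lifts to one vertex or to two joined by a single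
    edge, and a split lifts to the preimages of its two parts. Letting [T] be any part of [t @: S]
    is what makes the induction go through. *)
Lemma leftover_blowup (t : 'I_n -> 'I_n) (S T : {set 'I_n}) :
    {in S & &, forall x y z, t x = t y -> t x = t z -> x != y -> x != z -> y = z} ->
    {in S &, forall x y, {in S &, forall x' y', x != y -> x' != y' ->
       t x = t y -> f x y = f x' y' -> t x' = t x /\ t y' = t x}} ->
    {in S &, forall x y, {in S &, forall x' y', t x != t y -> t x' != t y' ->
       f x y = f x' y' <-> f (t x) (t y) = f (t x') (t y')}} ->
    leftover f T -> T \subset t @: S ->
  leftover f (S :&: t @^-1: T).
Proof.
move=> fib2 fib_col cross_col; elim=> {T} [v|A B al A0 B0 dAB _ IHA _ IHB cAB fAB alA alB] sT.
  have /imsetP[x xS vE] : v \in t @: S by rewrite (subsetP sT) ?set11.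
  have [/existsP[y /and3P[yS xy /eqP ty]]|/existsPn no] :=
      boolP [exists y, [&& y \in S, x != y & t y == v]]; last first.
    have -> : S :&: t @^-1: [set v] = [set x]; last exact: leftover_single.
    apply/setP=> z; rewrite !inE; apply/idP/eqP => [/andP[zS zv]|->].
      by apply/eqP; rewrite eq_sym; apply: contraNT (no z) => xz; rewrite zS xz.
    by rewrite xS vE eqxx.
  have -> : S :&: t @^-1: [set v] = [set x] :|: [set y].
    apply/setP=> z; rewrite !inE; apply/idP/orP => [/andP[zS /eqP zv]|[] /eqP->].
    - have [->|xz] := eqVneq z x; [by left|right].
      by rewrite (fib2 x z y) // -?vE ?ty // eq_sym.
    - by rewrite xS vE eqxx.
    - by rewrite yS ty eqxx.
  have nocol z c : c \in colors_in f [set z] = false.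
    by apply/colors_inP => -[x' [y' []]]; rewrite !inE => /eqP-> /eqP->; rewrite eqxx.
  apply: (@leftover_split _ _ _ _ (f x y)); rewrite ?nocol //; try exact: leftover_single.
  - by apply/set0Pn; exists x; rewrite set11.
  - by apply/set0Pn; exists y; rewrite set11.
  - by rewrite disjoints1 inE.
  - by move=> c; rewrite nocol.
  - by move=> a b; rewrite !inE => /eqP-> /eqP->.
have sA : A \subset t @: S by apply: subset_trans sT; apply: subsetUl.
have sB : B \subset t @: S by apply: subset_trans sT; apply: subsetUr.
have disj v : v \in A -> v \in B -> False.
  by move=> vA vB; move/disjoint_setI0/setP/(_ v): dAB; rewrite !inE vA vB.
have lift (C : {set 'I_n}) : C \subset t @: S -> C != set0 -> exists2 x, x \in S & t x \in C.
  by move=> sC /set0Pn[v vC]; have /imsetP[x xS vE] := subsetP sC v vC; exists x; rewrite // -vE.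
have [a0 a0S ta0] := lift A sA A0; have [b0 b0S tb0] := lift B sB B0.
have neqAB v w : v \in A -> w \in B -> v != w.
  by move=> vA wB; apply/eqP => vw; apply: (disj v) => //; rewrite vw.
have colC (C : {set 'I_n}) x y : x \in S -> y \in S -> t x \in C -> t y \in C -> t x != t y ->
    f (t x) (t y) \in colors_in f C.
  by move=> xS yS xC yC xy; apply/colors_inP; exists (t x), (t y).
have alC (C : {set 'I_n}) : C \subset t @: S -> C = A \/ C = B ->
    f a0 b0 \notin colors_in f (S :&: t @^-1: C).
  move=> sC CE; apply/colors_inP => -[x [y []]]; rewrite !inE.
  move=> /andP[xS xC] /andP[yS yC] xy fxy.
  have [txy|txy] := eqVneq (t x) (t y).
    have ab : a0 != b0 by apply: contraNneq (neqAB _ _ ta0 tb0) => ->.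
    have [ea eb] := fib_col x y xS yS a0 b0 a0S b0S xy ab txy fxy.
    by move: (neqAB _ _ ta0 tb0); rewrite ea eb eqxx.
  have := colC C x y xS yS xC yC txy.
  have [/(_ fxy) -> _] := cross_col x y xS yS a0 b0 a0S b0S txy (neqAB _ _ ta0 tb0).
  by rewrite fAB //; case: CE => ->; rewrite ?(negPf alA) ?(negPf alB).
rewrite preimsetU setIUr; apply: (@leftover_split _ _ _ _ (f a0 b0)).
- by apply/set0Pn; exists a0; rewrite !inE a0S.
- by apply/set0Pn; exists b0; rewrite !inE b0S.
- by apply/pred0P => x /=; rewrite !inE; apply/negP => /andP[/andP[_ xA] /andP[_ /disj]]; exact.
- exact: IHA.
- exact: IHB.
- move=> c /colors_inP[x [y []]]; rewrite !inE => /andP[xS xA] /andP[yS yA] xy <-.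
  apply/colors_inP => -[x' [y' []]]; rewrite !inE => /andP[x'S x'B] /andP[y'S y'B] xy' fE.
  (* A shared colour occurring inside a fibre would place that fibre over both [A] and [B]; a shared
     colour of crossing pairs descends to a colour common to [A] and [B]. *)
  have [txy|txy] := eqVneq (t x) (t y).
    have [E _] := fib_col x y xS yS x' y' x'S y'S xy xy' txy (esym fE).
    by apply: (disj (t x)) => //; rewrite -E.
  have [txy'|txy'] := eqVneq (t x') (t y').
    have [E _] := fib_col x' y' x'S y'S x y xS yS xy' xy txy' fE.
    by apply: (disj (t x)) => //; rewrite E.
  have [/(_ (esym fE)) E _] := cross_col x y xS yS x' y' x'S y'S txy txy'.
  move: (colC A x y xS yS xA yA txy); rewrite E => /cAB /negP; apply.
  exact: colC.
- move=> a b; rewrite !inE => /andP[aS aA] /andP[bS bB].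
  by apply/cross_col; rewrite ?neqAB // !fAB.
- by apply: alC => //; left.
- by apply: alC => //; right.
Qed.

End Colors.

(** * Counting colours along the fibres of a reduction map *)

(* [tf] and [rh] read off a colour of [f] the colour of the reduced pair and a
   record; [e (u, v)] is the record of a pair with a-values u, v, and [z0] the
   record of a pair with equal a-values. *)
Section FiberColoring.
Context {n : nat} (f : edge_coloring n) (S : {set 'I_n}) (t a : 'I_n -> 'I_n).
Context (R : eqType) (k0 : nat) (z0 : R) (e : 'I_n * 'I_n -> R).
Context (rh : nat -> R) (tf : nat -> nat).
Hypothesis f_sym : symmetric_coloring f.
Hypothesis f_diag : forall x, f x x = k0.
Hypothesis f_k0 : forall x y, x != y -> f x y != k0.
Hypothesis ta_inj : {in S &, forall x y, t x = t y -> a x = a y -> x = y}.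
Hypothesis tfE : forall x y, tf (f x y) = f (t x) (t y).
Hypothesis t_lt : forall x y, t x < t y -> x < y.
Hypothesis a_lt : {in S &, forall x y, t x = t y -> x < y -> a x < a y}.
Hypothesis rh_z0 : {in S &, forall x y, a x = a y -> rh (f x y) = z0}.
Hypothesis rh_e : {in S &, forall x y : 'I_n, {in S &, forall x' y' : 'I_n, x < y ->
  t x' = t y' -> a x = a x' -> a y = a y' -> a x != a y ->
  rh (f x y) = e (a x, a y)}}.
Hypothesis e_inj : injective e.
Hypothesis e_z0 : forall p, e p != z0.
Hypothesis t_small : #|t @: S| < #|S|.
Hypothesis IH : forall T : {set 'I_n}, T != set0 -> #|T| < #|S| ->
  #|T| <= (ncolors f T).+1.

Let V p := [set v in t @: S | [exists x in S, exists y in S,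
  [&& t x == v, t y == v, a x == p.1 & a y == p.2]]].
(** [V] is symmetric in the two values, so [E] lists each unordered pair once. *)
Let E := [set p : 'I_n * 'I_n | (p.1 < p.2) && (V p != set0)].

Let VP p v : v \in V p ->
  exists x y, [/\ x \in S, y \in S, t x = v, t y = v & a x = p.1 /\ a y = p.2].
Proof.
rewrite inE => /andP[_ /existsP[x /andP[xS /existsP[y /andP[yS]]]]].
by case/and4P => /eqP ? /eqP ? /eqP ? /eqP ?; exists x, y.
Qed.

Let inV x y : x \in S -> y \in S -> t x = t y -> t x \in V (a x, a y).
Proof.
move=> xS yS txy; rewrite inE imset_f //=.
apply/existsP; exists x; rewrite xS; apply/existsP; exists y.
by rewrite yS -txy !eqxx.
Qed.

Let inE_V x y : x \in S -> y \in S -> t x = t y -> x < y -> (a x, a y) \in E.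
Proof.
move=> xS yS txy lt_xy; rewrite inE /= a_lt //.
by apply/set0Pn; exists (t x); apply: inV.
Qed.

(* Blurring the record of a pair whose reduced colour occurs on no pair with
   record z0 makes each colour of t @: S visible with record z0. *)
Let Z g := [exists x in S, exists y in S,
  [&& t x != t y, f (t x) (t y) == g & rh (f x y) == z0]].
Let P c := if (tf c == k0) || Z (tf c) then (tf c, rh c) else (tf c, z0).

Let inZ x y : x \in S -> y \in S -> t x != t y -> a x = a y -> Z (f (t x) (t y)).
Proof.
move=> xS yS txy axy; apply/existsP; exists x; rewrite xS.
by apply/existsP; exists y; rewrite yS txy eqxx rh_z0 /=.
Qed.

Let P_in x y : x \in S -> y \in S -> x != y ->
  P (f x y) \in map P (colors_in f S).
Proof. by move=> xS yS xy; apply: map_f; apply/colors_inP; exists x, y. Qed.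

Let P_fiber x y : x \in S -> y \in S -> t x = t y -> x < y ->
  P (f x y) = (k0, e (a x, a y)).
Proof.
move=> xS yS txy lt_xy; rewrite /P tfE txy f_diag eqxx /=; congr pair.
apply: (rh_e xS yS xS yS) => //.
by move: (a_lt xS yS txy lt_xy); rewrite ltn_neqAle => /andP[].
Qed.

(** The pair with value [p.1] over [v] and [p.2] over [w] has record [e p]. The pair with value
    [p.1] over both has record [z0], so [Z] holds and [P] does not blur. Only [p.1 != p.2] is asked,
    so decreasing pairs are allowed. *)
Let P_cross p v w : p.1 != p.2 -> v \in V p -> w \in V p -> v < w ->
  (f v w, e p) \in map P (colors_in f S).
Proof.
move=> p12 /VP[x [y [xS yS tx ty [ax ay]]]] /VP[x' [y' [x'S y'S tx' ty' [ax' ay']]]] vw.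
have vDw : v != w by rewrite -(inj_eq val_inj) neq_ltn vw.
have lt_xy : x < y' by apply: t_lt; rewrite tx ty'.
have -> : (f v w, e p) = P (f x y'); last first.
  by apply: P_in => //; rewrite -(inj_eq val_inj) neq_ltn lt_xy.
have Zvw : Z (f v w) by rewrite -tx -tx'; apply: inZ; rewrite ?tx ?tx' ?ax ?ax'.
rewrite /P tfE tx ty' Zvw orbT; congr pair.
by rewrite (rh_e xS y'S xS yS) ?ax ?ay' ?tx ?ty -?surjective_pairing.
Qed.

Let W := [seq (k0, e p) | p <- enum E] ++
  [seq (g, e p) | p <- enum E, g <- colors_in f (V p)] ++
  [seq (g, z0) | g <- colors_in f (t @: S)].

Let k0_colors T : k0 \in colors_in f T = false.
Proof. by apply/colors_inP => -[x [y [_ _ /f_k0/eqP]]]. Qed.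

Let E_lt p : p \in E -> p.1 < p.2. Proof. by rewrite inE => /andP[]. Qed.

Let E_neq p : p \in E -> p.1 != p.2.
Proof. by move/E_lt; rewrite -(inj_eq val_inj) neq_ltn => ->. Qed.

Let W_sub : {subset W <= map P (colors_in f S)}.
Proof.
move=> w; rewrite !mem_cat => /or3P[/mapP[p]|/allpairsPdep[p [g [pE gV ->]]]|/mapP[g gT ->]].
- rewrite mem_enum => pE ->; have /set0Pn[v /VP[x [y [xS yS tx ty [ax ay]]]]] : V p != set0.
    by move: pE; rewrite inE => /andP[].
  have ltp := E_lt pE.
  have lt_xy : x < y.
    rewrite ltnNge leq_eqVlt; apply/negP => /orP[/eqP/val_inj xy|lt_yx].
      by move: ltp; rewrite -ax -ay xy ltnn.
    have := a_lt yS xS (etrans ty (esym tx)) lt_yx.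
    by rewrite ax ay ltnNge ltnW.
  have -> : (k0, e p) = P (f x y).
    by rewrite P_fiber ?tx ?ty // ax ay -surjective_pairing.
  by apply: P_in => //; rewrite -(inj_eq val_inj) neq_ltn lt_xy.
- move: pE; rewrite mem_enum => /E_neq np.
  case/colors_inP: gV => v [u [vV uV]]; rewrite -(inj_eq val_inj) neq_ltn => /orP[] lt <-.
    exact: P_cross.
  by rewrite f_sym; apply: P_cross.
(* If some pair realises [g] with record [z0], it serves; otherwise [P] blurs every pair above [g]
   and any lift serves. *)
- have [/existsP[x /andP[xS /existsP[y /andP[yS /and3P[txy /eqP fg /eqP rz]]]]]|nZ] := boolP (Z g).
    have -> : (g, z0) = P (f x y) by rewrite /P tfE fg rz; case: ifP.
    by apply: P_in => //; apply: contraNneq txy => ->.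
  case/colors_inP: gT => v [u [/imsetP[x xS vE] /imsetP[y yS uE] vu fg]].
  have -> : (g, z0) = P (f x y).
    by rewrite /P tfE -vE -uE fg (negPf nZ) -fg (negPf (f_k0 vu)).
  by apply: P_in => //; apply: contraNneq vu => xy; rewrite vE uE xy.
Qed.

(** The first family is told apart by [k0], which is the colour of no edge, and the third by [z0], a
    value that [e] avoids. *)
Let W_uniq : uniq W.
Proof.
rewrite !cat_uniq; apply/and5P; split.
- by rewrite map_inj_uniq ?enum_uniq // => p q [] /e_inj.
- apply/hasPn => w; rewrite mem_cat => /orP[/allpairsPdep[p [g [_ gV ->]]]|/mapP[g gT ->]];
    apply/mapP => -[q _ []].
    by move=> gk; rewrite gk k0_colors in gV.
  by move=> gk; rewrite gk k0_colors in gT.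
- apply: allpairs_uniq_dep; first exact: enum_uniq.
    by move=> p _; apply: undup_uniq.
  by move=> [p g] [q h] _ _ /= [-> /e_inj ->].
- apply/hasPn => w /mapP[g _ ->]; apply/allpairsPdep => -[p [h [_ _ [_ /eqP]]]].
  by rewrite eq_sym (negPf (e_z0 p)).
- by rewrite map_inj_uniq ?undup_uniq // => g h [].
Qed.

Let W_size : size W = \sum_(p in E) (ncolors f (V p)).+1 + ncolors f (t @: S).
Proof.
rewrite !size_cat !size_map -cardE size_allpairs_dep sumnE big_map big_enum /=.
rewrite addnA; congr (_ + _); under [in RHS]eq_bigr do rewrite -addn1.
by rewrite big_split /= sum1_card addnC.
Qed.

Let low x := [arg min_(y < x | (y \in S) && (t y == t x)) (y : nat)].

Let lowP x : x \in S -> [/\ low x \in S, t (low x) = t x &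
  forall y, y \in S -> t y = t x -> low x <= y].
Proof.
move=> xS; rewrite /low; case: arg_minnP => [|y /andP[yS /eqP ty] le_y].
  by rewrite xS eqxx.
by split=> // z zS tz; apply: le_y; rewrite zS tz eqxx.
Qed.

Let low_eq x y : x \in S -> y \in S -> t x = t y -> low x = low y.
Proof.
move=> xS yS txy; have [lxS tlx lx] := lowP xS; have [lyS tly ly] := lowP yS.
by apply/val_inj/eqP; rewrite eqn_leq lx ?ly // ?tlx ?tly.
Qed.

Let N := S :\: [set x | low x == x].
Let Phi := [set q : ('I_n * 'I_n) * 'I_n | (q.1 \in E) && (q.2 \in V q.1)].
(** Each non-minimal vertex of a fibre is charged to that fibre together with the pair of a-values
    it forms with the least vertex there. *)
Let phi x := ((a (low x), a x), t x).

Let Phi_card : #|Phi| = \sum_(p in E) #|V p|.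
Proof.
rewrite -sum1_card; under [RHS]eq_bigr do rewrite -sum1_card.
by rewrite pair_big_dep; apply: eq_bigl => q; rewrite inE.
Qed.

Let phi_inj : {in N &, injective phi}.
Proof.
move=> x y; rewrite !inE => /andP[_ xS] /andP[_ yS] [_ axy txy].
by apply: ta_inj => //; apply: val_inj.
Qed.

Let phi_sub : phi @: N \subset Phi.
Proof.
apply/subsetP=> q /imsetP[x]; rewrite in_setD inE => /andP[lx xS] ->.
have [lS tl le_l] := lowP xS.
have lt_l : low x < x by rewrite ltn_neqAle le_l // andbT (inj_eq val_inj).
by rewrite inE /= inE_V //= -{1}tl; apply: inV.
Qed.

Let card_S : #|S| <= #|t @: S| + #|N|.
Proof.
rewrite -(cardsID [set x | low x == x] S) leq_add2r.
rewrite -(@card_in_imset _ _ t (mem (S :&: [set x | low x == x]))).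
  by apply: subset_leq_card; apply: imsetS; apply: subsetIl.
move=> x y; rewrite !inE => /andP[xS /eqP lx] /andP[yS /eqP ly] txy.
by rewrite -lx -ly; apply: low_eq.
Qed.

Let N_le : #|N| <= #|Phi|.
Proof. by rewrite -(card_in_imset phi_inj) subset_leq_card. Qed.

Let V_le p : p \in E -> #|V p| <= (ncolors f (V p)).+1.
Proof.
rewrite inE => /andP[_ V0]; apply: IH => //; apply: leq_ltn_trans t_small.
by apply/subset_leq_card/subsetP => v; rewrite inE => /andP[].
Qed.

Let Phi_le : #|Phi| <= \sum_(p in E) (ncolors f (V p)).+1.
Proof. by rewrite Phi_card; apply: leq_sum => p; apply: V_le. Qed.

Let tS_le : #|t @: S| <= (ncolors f (t @: S)).+1.
Proof.
apply: IH => //; have /card_gt0P[x xS] : 0 < #|S| by apply: leq_trans t_small.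
by apply/set0Pn; exists (t x); apply: imset_f.
Qed.

(** Charging gives [#|S| <= #|t @: S| + \sum_(p in E) #|V p|]; induction bounds each size by a
    number of colours plus one, and the total is [(size W).+1]. *)
Lemma fiber_coloring_bound : #|S| <= (ncolors f S).+1.
Proof. 
have := ncolors_ge W_uniq W_sub; rewrite W_size; move: card_S N_le Phi_le tS_le.
by clear; move: #|S| #|N| #|Phi| #|t @: S| (bigop _ _ _) => *; lia.
Qed.

Hypothesis IH_tight : #|t @: S| = (ncolors f (t @: S)).+1 -> leftover f (t @: S).

(** Equality makes [P] injective on colours, [W] exhaust the values of [P], and [phi] map onto
    [Phi]; these yield the hypotheses of [leftover_blowup]. *)
Lemma fiber_coloring_tight : #|S| = (ncolors f S).+1 -> leftover f S.
Proof.
move=> tight.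
have [leW tST NPhi] : [/\ ncolors f S <= size W,
    #|t @: S| = (ncolors f (t @: S)).+1 & #|Phi| <= #|N|].
  have := ncolors_ge W_uniq W_sub; rewrite W_size.
  move: tight card_S N_le Phi_le tS_le; clear.
  by move: #|S| #|N| #|Phi| #|t @: S| (bigop _ _ _) => *; split; lia.
have P_inj := ncolors_tight W_uniq W_sub leW.
have W_all : {subset map P (colors_in f S) <= W}.
  have [|_ sub w] := uniq_min_size W_uniq W_sub; first by rewrite size_map.
  by rewrite sub.
have phiN : phi @: N = Phi.
  by apply/eqP; rewrite eqEcard phi_sub (card_in_imset phi_inj).
(* Two fibres in [V p] would also realise the reversed pair [q], giving a value with record [e q]
   that [W] lacks, since [E] holds increasing pairs only. *)
have V1 p v w : p \in E -> v \in V p -> w \in V p -> v = w.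
  move=> pE; wlog lt_vw : v w / v < w => [hw|] vV wV.
    have [lt|lt|/val_inj//] := ltngtP v w; first exact: hw.
    by apply/esym/hw.
  have np := E_neq pE; pose q := (p.2, p.1).
  have Vq u : u \in V p -> u \in V q.
    move=> /VP[x [y [xS yS tx ty [ax ay]]]]; rewrite -ty /q -ax -ay.
    by apply: inV; rewrite ?tx.
  have /W_all : (f v w, e q) \in map P (colors_in f S).
    by apply: P_cross; rewrite ?Vq // eq_sym.
  have vw : v != w by rewrite -(inj_eq val_inj) neq_ltn lt_vw.
  rewrite !mem_cat => /or3P[/mapP[q' _ []]|/allpairsPdep[q' [g [q'E _ [_ /e_inj]]]]|/mapP[q' _ [_]]].
  - by move/eqP; rewrite (negPf (f_k0 vw)).
  - move=> qq; move: q'E; rewrite mem_enum -qq => /E_lt /=.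
    by move=> lt_q; move: (E_lt pE); rewrite ltnNge ltnW.
  - by move/eqP; rewrite (negPf (e_z0 q)).
(* Each [V p] being a point, the second family of [W] is empty, so a crossing pair can only land in
   the third. *)
have P_crossz x y : x \in S -> y \in S -> t x != t y ->
    P (f x y) = (f (t x) (t y), z0).
  move=> xS yS txy; have nxy : x != y by apply: contraNneq txy => ->.
  have := W_all _ (P_in xS yS nxy); have : (P (f x y)).1 = f (t x) (t y).
    by rewrite /P tfE; case: ifP.
  case: (P _) => g r /= ->.
  rewrite !mem_cat => /or3P[/mapP[q' _ []]|/allpairsPdep[q' [g' [q'E gV [gE _]]]]|/mapP[g' _ [_ ->]]] //.
    by move/eqP; rewrite (negPf (f_k0 txy)).
  case/colors_inP: gV => v [w [vV wV vw _]]; rewrite mem_enum in q'E.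
  by rewrite (V1 _ _ _ q'E vV wV) eqxx in vw.
have colS x y : x \in S -> y \in S -> x != y -> f x y \in colors_in f S.
  by move=> xS yS xy; apply/colors_inP; exists x, y.
have -> : S = S :&: t @^-1: (t @: S).
  by apply/setP => x; rewrite !inE andb_idr // => xS; apply: imset_f.
apply: leftover_blowup => //; last exact: IH_tight.
(* The incidence of [(a y, a z)] with this fibre lies in [Phi], yet [phi] pairs [z] with the least
   vertex of the fibre, which is at most [x]. *)
- have fib3 x y z : x \in S -> y \in S -> z \in S -> t x = t y -> t x = t z ->
      x < y -> y < z -> False.
    move=> xS yS zS txy txz xy yz.
    have : ((a y, a z), t y) \in Phi.
      by rewrite inE /= inE_V ?inV // -txy.
    rewrite -phiN => /imsetP[u]; rewrite in_setD => /andP[_ uS] [ay az tu].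
    have uz : u = z by apply: ta_inj; rewrite // -?tu -?txy //; apply: val_inj.
    have [lS tl le_l] := lowP uS.
    have yl : y = low u by apply: ta_inj; rewrite ?tl //; apply: val_inj.
    by have := le_l x xS; rewrite -yl leqNgt xy -tu => /(_ txy).
  move=> x y z xS yS zS txy txz; have tyz := etrans (esym txy) txz.
  have sm (u v : 'I_n) : u != v -> u < v \/ v < u.
    by rewrite -(inj_eq val_inj) neq_ltn => /orP.
  move=> /sm xy /sm xz; apply/eqP; apply: contraT => /sm yz; suff []: False.
  case: xy xz yz => [xy|yx] [xz|zx] [yz|zy].
  + exact: (fib3 x y z).
  + exact: (fib3 x z y).
  + by move: (ltn_trans (ltn_trans xy yz) zx); rewrite ltnn.
  + by apply: (fib3 z x y).
  + by apply: (fib3 y x z).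
  + by move: (ltn_trans (ltn_trans zy yx) xz); rewrite ltnn.
  + by apply: (fib3 y z x).
  + by apply: (fib3 z y x).
- have key x y x' y' : x \in S -> y \in S -> x' \in S -> y' \in S ->
      x < y -> x' < y' -> t x = t y -> t x' = t y' -> f x y = f x' y' -> t x' = t x.
    move=> xS yS x'S y'S xy xy' txy txy' fE.
    have := P_fiber xS yS txy xy; rewrite fE P_fiber // => -[/e_inj[ax ay]].
    apply: (V1 (a x, a y)); [exact: inE_V| |exact: inV].
    by rewrite -ax -ay; apply: inV.
  move=> x y xS yS x' y' x'S y'S xy xy' txy fE.
  have txy' : t x' = t y'.
    apply/eqP; apply: contraLR (eqxx k0) => /f_k0.
    by rewrite -tfE -fE tfE txy f_diag.
  rewrite -txy'; suff: t x' = t x by [].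
  move: xy xy'; rewrite -!(inj_eq val_inj) !neq_ltn => /orP[xy|yx] /orP[xy'|yx'].
  + exact: (key x y x' y').
  + by rewrite txy'; apply: (key x y y' x'); rewrite // fE f_sym.
  + by rewrite txy; apply: (key y x x' y'); rewrite // f_sym.
  + by rewrite txy txy'; apply: (key y x y' x'); rewrite // f_sym fE f_sym.
- move=> x y xS yS x' y' x'S y'S txy txy'; split=> [fE|gE].
    by rewrite -!tfE fE.
  have neq_t u v : t u != t v -> u != v by apply: contraNneq => ->.
  apply: P_inj; [exact/colS/neq_t|exact/colS/neq_t|].
  by rewrite (P_crossz x y) // (P_crossz x' y') // gE.
Qed.

End FiberColoring.

(** * Value counts of composed maps, and a pigeonhole *)

Section Factor.
Context (X T1 T2 : eqType) (g : X -> T1) (h : T1 -> T2) (s : seq X).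

Lemma size_undup_factor :
  size (undup (map (h \o g) s)) <= size (undup (map g s)).
Proof.
rewrite -(size_map h (undup _)); apply: uniq_leq_size (undup_uniq _) _ => y.
rewrite mem_undup => /mapP[x xs ->]; apply: map_f.
by rewrite mem_undup map_f.
Qed.

Lemma size_undup_factor_inj :
    size (undup (map g s)) <= size (undup (map (h \o g) s)) ->
  {in s &, forall x y, h (g x) = h (g y) -> g x = g y}.
Proof.
move=> le_s x y xs ys.
have : uniq (map h (undup (map g s))).
  apply: leq_size_uniq (undup_uniq (map (h \o g) s)) _ _; last by rewrite size_map.
  move=> z; rewrite mem_undup => /mapP[u us ->]; apply: map_f.
  by rewrite mem_undup map_f.
by move=> /uniq_map_inj_in; apply; rewrite mem_undup map_f.
Qed.

End Factor.

(** Lets whatever depends only on the colour of a pair be read off that colour; [y0] is the value at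
    colours that never occur. *)
Lemma factor_through (X : finType) (Y : eqType) (g : X -> nat) (k : X -> Y) (y0 : Y) :
    (forall x x', g x = g x' -> k x = k x') ->
  exists h, forall x, h (g x) = k x.
Proof.
move=> gk; exists (fun c => if [pick x | g x == c] is Some x then k x else y0) => x.
by case: pickP => [x' /eqP/gk//|/(_ x)]; rewrite eqxx.
Qed.

(** Strict growth at every step would force [d <= w d] for all [d <= D]. *)
Lemma monotone_pigeonhole (w : nat -> nat) D :
  w D < D -> exists2 d, d < D & w d.+1 <= w d.
Proof.
move=> wD; have [/existsP[d le_w]|/existsPn no] := boolP [exists d : 'I_D, w d.+1 <= w d].
  by exists d.
suff /(_ D (leqnn D)) : forall d, d <= D -> d <= w d by rewrite leqNgt wD.
elim=> // d IH ltD; apply: leq_ltn_trans (IH (ltnW ltD)) _.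
by move: (no (Ordinal ltD)); rewrite -ltnNge.
Qed.

(** * Binary blocks, truncation and digit records *)

Definition block lo len x := (x %/ 2 ^ lo) %% 2 ^ len.
Definition trunc h x := x %/ 2 ^ h * 2 ^ h.

Lemma pow2_gt0 k : 0 < 2 ^ k. Proof. by rewrite expn_gt0. Qed.
#[local] Hint Resolve pow2_gt0 : core.

Lemma div_pow2D m k x : x %/ 2 ^ (m + k) = x %/ 2 ^ m %/ 2 ^ k.
Proof. by rewrite expnD divnMA. Qed.

Lemma trunc0 x : trunc 0 x = x.
Proof. by rewrite /trunc expn0 divn1 muln1. Qed.

Lemma trunc_leq h x : trunc h x <= x.
Proof. exact: leq_divM. Qed.

Lemma trunc_mono h x y : x <= y -> trunc h x <= trunc h y.
Proof. by move=> xy; rewrite leq_mul2r leq_div2r ?orbT. Qed.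

Lemma trunc_lt h x y : trunc h x < trunc h y -> x < y.
Proof. by apply: contraTT; rewrite -!leqNgt; apply: trunc_mono. Qed.

Lemma trunc_inj h x y : trunc h x = trunc h y -> x %/ 2 ^ h = y %/ 2 ^ h.
Proof. by move/eqP; rewrite eqn_pmul2r // => /eqP. Qed.

Lemma trunc_div h lo x : trunc h x %/ 2 ^ lo = trunc (h - lo) (x %/ 2 ^ lo).
Proof.
have [le|/ltnW le] := leqP h lo.
  rewrite (eqP le) trunc0 -(subnKC le) !div_pow2D.
  by rewrite mulnK.
by rewrite /trunc -div_pow2D subnKC // -{2}(subnKC le) expnD mulnA mulnAC mulnK.
Qed.

Lemma trunc_mod h r x : trunc h x %% 2 ^ r = trunc h (x %% 2 ^ r).
Proof.
rewrite /trunc; have [le|/ltnW le] := leqP r h.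
  rewrite (divn_small (leq_trans (ltn_pmod x (pow2_gt0 r)) _)) ?leq_pexp2l // mul0n.
  by apply/eqP; apply: dvdn_mull; apply: dvdn_exp2l.
by rewrite -(subnK le) expnD -modn_divl -muln_modl.
Qed.

(** Truncated subtraction covers all cases: [h - lo] is 0 when the cut lies below the block, and at
    least [len] when it lies above, erasing the block. *)
Lemma block_trunc h lo len x :
  block lo len (trunc h x) = trunc (h - lo) (block lo len x).
Proof. by rewrite /block trunc_div trunc_mod. Qed.

Lemma block_lt lo len x : block lo len x < 2 ^ len.
Proof. exact: ltn_pmod. Qed.

Lemma block_leq lo len x : block lo len x <= x.
Proof. exact: leq_trans (leq_mod _ _) (leq_div _ _). Qed.

Lemma block_div lo len k x : k <= len ->
  block lo len x %/ 2 ^ k = block (lo + k) (len - k) x.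
Proof. by move=> le; rewrite /block -{1}(subnK le) expnD -modn_divl -div_pow2D. Qed.

Lemma block_block lo len lo' len' x : lo' <= lo -> lo + len <= lo' + len' ->
  block (lo - lo') len (block lo' len' x) = block lo len x.
Proof.
move=> le le'; rewrite {1}/block block_div; last by lia.
rewrite subnKC // /block modn_dvdm //; apply: dvdn_exp2l; lia.
Qed.

Lemma div_blockE lo len x :
  x %/ 2 ^ lo = x %/ 2 ^ (lo + len) * 2 ^ len + block lo len x.
Proof. by rewrite div_pow2D; apply: divn_eq. Qed.

(* The position (from 1) and contents of the leading r-bit digit in which two
   b-digit numbers differ; position 0 means that they are equal. *)
Definition digit_diff b r U V : nat * nat * nat :=
  if find (fun c => U %/ 2 ^ (c * r) == V %/ 2 ^ (c * r)) (iota 0 b.+1) is k.+1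
  then (k.+1, block (k * r) r U, block (k * r) r V) else (0, 0, 0).

Lemma digit_diff_refl b r U : digit_diff b r U U = (0, 0, 0).
Proof. by rewrite /digit_diff /= eqxx. Qed.

Lemma digit_diffE b r k U V : k < b ->
    U %/ 2 ^ (k.+1 * r) = V %/ 2 ^ (k.+1 * r) -> U %/ 2 ^ (k * r) != V %/ 2 ^ (k * r) ->
  digit_diff b r U V = (k.+1, block (k * r) r U, block (k * r) r V).
Proof.
move=> kb eqS neq; rewrite /digit_diff; case: findP => [/hasPn/(_ k.+1)|i].
  by rewrite mem_iota /= eqS eqxx ltnS kb => /(_ isT).
rewrite size_iota => ib /(_ 0) eqi nlt; suff -> : i = k.+1 by [].
apply/eqP; rewrite eqn_leq; apply/andP; split; rewrite leqNgt; apply/negP => lt.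
  by move: (nlt 0 _ lt); rewrite nth_iota // ?add0n ?eqS ?eqxx.
move: neq; rewrite nth_iota // add0n in eqi.
have -> : k * r = i * r + (k - i) * r by rewrite -mulnDl subnKC.
by rewrite !div_pow2D (eqP eqi) eqxx.
Qed.

Variant digit_diff_spec b r U V : Prop :=
| DigitDiffEq of U = V
| DigitDiffNeq k of k < b & U %/ 2 ^ (k.+1 * r) = V %/ 2 ^ (k.+1 * r)
    & U %/ 2 ^ (k * r) != V %/ 2 ^ (k * r).

Lemma digit_diffP b r U V : U < 2 ^ (b * r) -> V < 2 ^ (b * r) -> digit_diff_spec b r U V.
Proof.
move=> Ub Vb; have ex : exists c, U %/ 2 ^ (c * r) == V %/ 2 ^ (c * r).
  by exists b; rewrite !divn_small.
case: (ex_minnP ex) => -[|k] /eqP eqk mink.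
  by left; rewrite mul0n expn0 !divn1 in eqk.
right with k => //; last by apply/negP => /mink; rewrite ltnn.
by apply: mink; rewrite !divn_small.
Qed.

(** Positions being counted from 1, the recorded digit starts at bit [c.-1 * r]. *)
Definition trunc_diff h r (q : nat * nat * nat) :=
  let: (c, X, Y) := q in
  let X' := trunc (h - c.-1 * r) X in let Y' := trunc (h - c.-1 * r) Y in
  if X' == Y' then (0, 0, 0) else (c, X', Y').

(** If truncation makes the leading differing digits equal, the cut lies above the start of that
    digit, so all lower bits are erased too and the truncated numbers coincide. *)
Lemma digit_diff_trunc b r h U V : U < 2 ^ (b * r) -> V < 2 ^ (b * r) ->
  digit_diff b r (trunc h U) (trunc h V) = trunc_diff h r (digit_diff b r U V).
Proof.
move=> Ub Vb; case: (digit_diffP Ub Vb) => [<-|k kb eqS neq].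
  by rewrite !digit_diff_refl /trunc_diff eqxx.
rewrite (digit_diffE kb eqS neq) /trunc_diff /= -!block_trunc.
have eqS' : trunc h U %/ 2 ^ (k.+1 * r) = trunc h V %/ 2 ^ (k.+1 * r).
  by rewrite !trunc_div eqS.
case: eqP => [eqX|/eqP neqX]; last first.
  by apply: digit_diffE => //; apply: contraNneq neqX; rewrite /block => ->.
have eqk : trunc h U %/ 2 ^ (k * r) = trunc h V %/ 2 ^ (k * r).
    rewrite (div_blockE (k * r) r (trunc h U)) (div_blockE (k * r) r (trunc h V)).
    by rewrite eqX (addnC (k * r)) -mulSn eqS'.
suff -> : trunc h U = trunc h V by rewrite digit_diff_refl.
rewrite !trunc_div in eqk; have [le|/ltnW le] := leqP h (k * r).
  by move: neq; rewrite (eqP le) !trunc0 in eqk; rewrite eqk eqxx.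
by rewrite /trunc -(subnKC le) !div_pow2D (trunc_inj eqk).
Qed.

(** * The block colouring and its compatibility with truncation *)

Section BlockColoring.
Context (b D : nat).
Hypothesis b_gt0 : 0 < b.

Definition level_diff d P x y : nat * nat * nat :=
  digit_diff b (b ^ d) (block (P * b ^ d.+1) (b ^ d.+1) x)
    (block (P * b ^ d.+1) (b ^ d.+1) y).

Definition level_diffs d x y :=
  [seq level_diff d P x y | P <- iota 0 (b ^ (D - d.+1))].

Definition all_diffs x y := [seq level_diffs d x y | d <- iota 0 D].

(** Ordering the pair first makes the colour symmetric; [pickle] encodes the table of records
    injectively as a natural number. *)
Definition block_code x y : nat := pickle (all_diffs (minn x y) (maxn x y)).

Definition block_coloring n : edge_coloring n := fun x y => block_code x y.

Lemma level_diff_refl d P x : level_diff d P x x = (0, 0, 0).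
Proof. exact: digit_diff_refl. Qed.

Lemma all_diffs_eq x y x' y' : all_diffs x y = all_diffs x' y' <->
  (forall d P, d < D -> P < b ^ (D - d.+1) -> level_diff d P x y = level_diff d P x' y').
Proof.
split=> [/eq_in_map eq_d d P dD PD|eq_lev].
  have /eq_in_map : level_diffs d x y = level_diffs d x' y'.
    by apply: eq_d; rewrite mem_iota.
  by apply; rewrite mem_iota.
apply/eq_in_map => d; rewrite mem_iota => /andP[_ dD].
by apply/eq_in_map => P; rewrite mem_iota => /andP[_ PD]; apply: eq_lev.
Qed.

Lemma level_diff_trunc h d P x y :
  level_diff d P (trunc h x) (trunc h y) =
  trunc_diff (h - P * b ^ d.+1) (b ^ d) (level_diff d P x y).
Proof.
by rewrite /level_diff !block_trunc digit_diff_trunc // -expnS; apply: block_lt.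
Qed.

Lemma block_codeC x y : block_code x y = block_code y x.
Proof. by rewrite /block_code minnC maxnC. Qed.

Lemma block_code_eq x y x' y' : block_code x y = block_code x' y' <->
  (forall d P, d < D -> P < b ^ (D - d.+1) ->
   level_diff d P (minn x y) (maxn x y) = level_diff d P (minn x' y') (maxn x' y')).
Proof. by rewrite -all_diffs_eq; split=> [/(pcan_inj pickleK)|] // E; congr pickle. Qed.

(** Truncation is monotone, so it commutes with [minn] and [maxn], and it acts on each record
    through [trunc_diff]. *)
Lemma block_code_trunc h x y x' y' : block_code x y = block_code x' y' ->
  block_code (trunc h x) (trunc h y) = block_code (trunc h x') (trunc h y').
Proof.
have mm u v : minn (trunc h u) (trunc h v) = trunc h (minn u v) /\
              maxn (trunc h u) (trunc h v) = trunc h (maxn u v).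
  by case: (leqP u v) => [|/ltnW] /(trunc_mono h) le; split;
    [apply/minn_idPl|apply/maxn_idPr|apply/minn_idPr|apply/maxn_idPl].
move/block_code_eq => eq_lev; apply/block_code_eq => d P dD PD.
have [-> ->] := mm x y; have [-> ->] := mm x' y'.
by rewrite !level_diff_trunc eq_lev.
Qed.

Lemma block_code_diag x y : block_code x x = block_code y y.
Proof. by apply/block_code_eq => d P _ _; rewrite !minnn !maxnn !level_diff_refl. Qed.

(** At the top level [D.-1] the only block is the whole string, so its record is nonzero as soon as
    the numbers differ. *)
Lemma block_code_neq_diag x y : 0 < D -> x < 2 ^ (b ^ D) -> y < 2 ^ (b ^ D) ->
  x != y -> block_code x y != block_code 0 0.
Proof.
move=> D0 xb yb xy; apply/eqP => /block_code_eq/(_ D.-1 0).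
rewrite level_diff_refl prednK // subnn leqnn => /(_ isT isT).
have blockT z : z < 2 ^ (b ^ D) -> block (0 * b ^ D) (b ^ D) z = z.
  by move=> zb; rewrite /block divn1 modn_small.
rewrite /level_diff prednK //.
wlog lt_xy : x y xb yb xy / x < y => [hw|].
  move: (xy); rewrite neq_ltn => /orP[lt|lt]; first exact: hw.
  by rewrite minnC maxnC; apply: hw; rewrite // eq_sym.
rewrite (minn_idPl (ltnW lt_xy)) (maxn_idPr (ltnW lt_xy)) !blockT //.
have bE : b ^ D = b * b ^ D.-1 by rewrite -expnS prednK.
rewrite bE in xb yb.
case: (digit_diffP xb yb) => [E|k kb eqS neq]; first by rewrite E eqxx in xy.
by rewrite (digit_diffE kb eqS neq).
Qed.

(** * Small cliques of the block colouring *)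

Section Clique.
Context (n p : nat).
Hypothesis n_le : n <= 2 ^ (b ^ D).
Hypothesis D_gt : p + p < D.

Let f : edge_coloring n := @block_coloring n.

Let tr h (x : 'I_n) : 'I_n := Ordinal (leq_ltn_trans (trunc_leq h x) (ltn_ord x)).
Let bl lo len (x : 'I_n) : 'I_n :=
  Ordinal (leq_ltn_trans (block_leq lo len x) (ltn_ord x)).

Section Level.
Context (S : {set 'I_n}) (q : nat).
Hypothesis S_p : #|S| <= p.
Hypothesis q_inj : {in S &, forall x y : 'I_n, x %/ 2 ^ q = y %/ 2 ^ q -> x = y}.

(** [lo d] and [hi d] delimit the aligned block of [b ^ d] bits containing bit [q]; these blocks are
    nested as [d] grows. *)
Let lo d := q %/ b ^ d * b ^ d.
Let hi d := (q %/ b ^ d).+1 * b ^ d.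
Let top d (x : 'I_n) := x %/ 2 ^ hi d.
Let blk d (x : 'I_n) := block (lo d) (b ^ d) x.

Let hiE d : hi d = lo d + b ^ d. Proof. by rewrite /hi mulSn addnC. Qed.

Let lo_leq d : lo d.+1 <= lo d.
Proof. by rewrite /lo expnSr divnMA (mulnC (b ^ d)) mulnA leq_mul2r leq_divM orbT. Qed.

Let hi_leq d : hi d <= hi d.+1.
Proof.
by rewrite /hi expnSr divnMA (mulnC (b ^ d)) mulnA leq_mul2r ltn_ceil // orbT.
Qed.

Let topS d x : top d.+1 x = top d x %/ 2 ^ (hi d.+1 - hi d).
Proof. by rewrite /top -div_pow2D subnKC. Qed.

Let blkS d x : blk d x = block (lo d - lo d.+1) (b ^ d) (blk d.+1 x).
Proof. by rewrite /blk block_block // -!hiE. Qed.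

Let nvals (g : 'I_n -> nat) := size (undup (map g (enum S))).

Let nvals_leq g : nvals g <= p.
Proof. by apply: leq_trans (size_undup _) _; rewrite size_map -cardE. Qed.

Lemma stable_level : exists2 d, d < D &
  {in S &, forall x y, top d.+1 x = top d.+1 y -> top d x = top d y} /\
  {in S &, forall x y, blk d x = blk d y -> blk d.+1 x = blk d.+1 y}.
Proof.
have topE d : map (top d.+1) (enum S) =
    map ((fun u => u %/ 2 ^ (hi d.+1 - hi d)) \o top d) (enum S).
  by apply: eq_map => x; apply: topS.
have blkE d : map (blk d) (enum S) =
    map (block (lo d - lo d.+1) (b ^ d) \o blk d.+1) (enum S).
  by apply: eq_map => x; apply: blkS.
have top_le d : nvals (top d.+1) <= nvals (top d).
  by rewrite /nvals (topE d); apply: size_undup_factor.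
have blk_le d : nvals (blk d) <= nvals (blk d.+1).
  by rewrite /nvals (blkE d); apply: size_undup_factor.
(* Both terms are nondecreasing in [d] and their sum is at most [p + p < D], so some step leaves
   both counts unchanged. *)
pose w d := nvals (blk d) + (p - nvals (top d)).
have [|d dD le_w] := @monotone_pigeonhole w D.
  by apply: leq_ltn_trans D_gt; apply: leq_add => //; apply: leq_subr.
have [eq_top eq_blk] : nvals (top d) <= nvals (top d.+1) /\ nvals (blk d.+1) <= nvals (blk d).
  by move: le_w (top_le d) (blk_le d) (nvals_leq (top d)); rewrite /w; lia.
exists d => //; split=> x y xS yS E.
  rewrite /nvals (topE d) in eq_top; apply: (size_undup_factor_inj eq_top);
    by rewrite ?mem_enum // -!topS.
rewrite /nvals (blkE d) in eq_blk; apply: (size_undup_factor_inj eq_blk);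
  by rewrite ?mem_enum // -!blkS.
Qed.

Hypothesis q_lt : q < b ^ D.
Hypothesis q_branch : exists x y, [/\ x \in S, y \in S, x != y & x %/ 2 ^ q.+1 = y %/ 2 ^ q.+1].
Hypothesis IH : forall T : {set 'I_n}, T != set0 -> #|T| < #|S| ->
  #|T| <= (ncolors f T).+1 /\ (#|T| = (ncolors f T).+1 -> leftover f T).

Lemma clique_step :
  #|S| <= (ncolors f S).+1 /\ (#|S| = (ncolors f S).+1 -> leftover f S).
Proof.
have [d dD [top_inj blk_inj]] := stable_level.
pose r := b ^ d; pose t := tr (hi d.+1); pose a := bl (lo d) r.
(* The larger block has index [P], and the smaller one is its digit number [k], counted from the low
   end starting at 0. *)
pose P := q %/ b ^ d.+1; pose k := q %/ b ^ d %% b.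
have r_gt0 j : 0 < b ^ j by rewrite expn_gt0 b_gt0.
have tE x y : t x = t y -> top d.+1 x = top d.+1 y by move/(congr1 val)/trunc_inj.
have loE : lo d = lo d.+1 + k * r.
  rewrite /lo {1}(divn_eq (q %/ b ^ d) b) -divnMA -expnSr mulnDl -mulnA.
  by rewrite -expnS.
have hi_div (x : 'I_n) : x %/ 2 ^ lo d = top d x * 2 ^ r + a x.
  by rewrite /top hiE; apply: div_blockE.
have k_lt : k < b by apply: ltn_pmod.
have digit x : block (k * r) r (blk d.+1 x) = a x.
  by rewrite -[RHS]/(blk d x) (blkS d) loE addKn.
have digit_top x : blk d.+1 x %/ 2 ^ (k.+1 * r) = top d x %% 2 ^ (b ^ d.+1 - k.+1 * r).
  rewrite block_div; last by rewrite expnS leq_mul2r k_lt orbT.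
  by rewrite /block /top hiE loE mulSn (addnC r) addnA.
have P_lt : P < b ^ (D - d.+1).
  by rewrite ltn_divLR // -expnD subnK.
have ta_inj : {in S &, forall x y, t x = t y -> a x = a y -> x = y}.
  move=> x y xS yS /tE/(top_inj _ _ xS yS) topE aE; apply: q_inj => //.
  have lo_q : lo d <= q by apply: leq_divM.
  by rewrite -(subnKC lo_q) !div_pow2D !hi_div topE aE.
(* Since [q < hi d.+1], [t] merges the two vertices that branch at bit [q]. *)
have t_small : #|t @: S| < #|S|.
  have [x [y [xS yS xy eq_q]]] := q_branch.
  rewrite ltn_neqAle leq_imset_card andbT; apply/imset_injP => t_inj.
  case/eqP: xy; apply: t_inj => //; apply: val_inj => /=.
  have q_hi : q.+1 <= hi d.+1 by apply: ltn_ceil.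
  by rewrite /trunc -(subnKC q_hi) !div_pow2D eq_q.
have a_lt : {in S &, forall x y, t x = t y -> x < y -> a x < a y}.
  move=> x y xS yS txy lt_xy; rewrite ltn_neqAle; apply/andP; split.
    by apply: contraTneq lt_xy => /val_inj/(ta_inj _ _ xS yS txy) ->; rewrite ltnn.
  have := leq_div2r (2 ^ lo d) (ltnW lt_xy).
  by rewrite !hi_div (top_inj _ _ xS yS (tE _ _ txy)) leq_add2l.
have [tf tfE] := @factor_through ('I_n * 'I_n)%type nat (fun z => f z.1 z.2)
  (fun z => f (t z.1) (t z.2)) 0 (fun z z' => @block_code_trunc _ _ _ _ _).
have [|rh rhE] := @factor_through ('I_n * 'I_n)%type _ (fun z => f z.1 z.2)
  (fun z => level_diff d P (minn z.1 z.2) (maxn z.1 z.2)) (0, 0, 0).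
  by move=> z z' /block_code_eq; apply.
have rh_z0 : {in S &, forall x y, a x = a y -> rh (f x y) = (0, 0, 0)}.
  move=> x y xS yS /(congr1 val)/(blk_inj _ _ xS yS) E.
  rewrite (rhE (x, y)) /= /level_diff -/(blk d.+1 _).
  by case: (leqP x y) => _; rewrite -![block _ _ _]/(blk d.+1 _) E digit_diff_refl.
pose e (u : 'I_n * 'I_n) : nat * nat * nat := (k.+1, val u.1, val u.2).
(* The fibre mates [x'] and [y'] have the same larger blocks as [x] and [y], so these blocks agree
   above digit [k], while [a x != a y] makes them differ at it. *)
have rh_e : {in S &, forall x y : 'I_n, {in S &, forall x' y' : 'I_n, x < y ->
    t x' = t y' -> a x = a x' -> a y = a y' -> a x != a y -> rh (f x y) = e (a x, a y)}}.
  move=> x y xS yS x' y' x'S y'S lt_xy /tE/(top_inj _ _ x'S y'S) topE.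
  move=> /(congr1 val)/(blk_inj _ _ xS x'S) Ex /(congr1 val)/(blk_inj _ _ yS y'S) Ey neq.
  rewrite (rhE (x, y)) /= (minn_idPl (ltnW lt_xy)) (maxn_idPr (ltnW lt_xy)).
  have -> : e (a x, a y) = (k.+1, block (k * r) r (blk d.+1 x), block (k * r) r (blk d.+1 y)).
    by rewrite !digit.
  apply: digit_diffE => //.
    by rewrite -/(blk d.+1 _) -/(blk d.+1 _) Ex Ey !digit_top topE.
  apply: contraNneq neq => E; apply/eqP/val_inj; change (a x = a y :> nat).
  by rewrite -!digit; congr (_ %% _).
have e_inj : injective e by move=> [u v] [u' v'] [] /val_inj-> /val_inj->.
have bound := @fiber_coloring_bound n f S t a _ (block_code 0 0) (0, 0, 0) e rh tf.
have tight := @fiber_coloring_tight n f S t a _ (block_code 0 0) (0, 0, 0) e rh tf.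
have f_sym : symmetric_coloring f by move=> x y; apply: block_codeC.
have f_diag x : f x x = block_code 0 0 by apply: block_code_diag.
have f_neq (x y : 'I_n) : x != y -> f x y != block_code 0 0.
  by move=> xy; apply: block_code_neq_diag; rewrite ?(leq_trans (ltn_ord _) n_le) //; lia.
split; [apply: bound|apply: tight] => //.
- by move=> x y; rewrite (tfE (x, y)).
- by move=> x y; apply: trunc_lt.
- by move=> T T0 /(IH T0)[].
- by move=> x y; rewrite (tfE (x, y)).
- by move=> x y; apply: trunc_lt.
- by move=> T T0 /(IH T0)[].
- apply IH => //; have [x [_ [xS _ _ _]]] := q_branch.
  by apply/set0Pn; exists (t x); apply: imset_f.
Qed.

End Level.
Lemma clique_bound (S : {set 'I_n}) : S != set0 -> #|S| <= p ->
  #|S| <= (ncolors f S).+1 /\ (#|S| = (ncolors f S).+1 -> leftover f S).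
Proof.
have [m] := ubnP #|S|; elim: m S => // m IHm S ltSm S0 Sp.
have [S1|S_gt1] := leqP #|S| 1.
  have /cards1P[x ->] : #|S| == 1 by rewrite eqn_leq S1 card_gt0.
  by split=> [|_]; [rewrite cards1|apply: leftover_single].
pose Q q := [exists x in S, exists y in S, (x != y) && (x %/ 2 ^ q == y %/ 2 ^ q)].
have QP q : reflect (exists x y, [/\ x \in S, y \in S, x != y & x %/ 2 ^ q = y %/ 2 ^ q]) (Q q).
  apply: (iffP existsP) => [[x /andP[xS /existsP[y /and3P[yS xy /eqP E]]]]|[x [y [xS yS xy E]]]].
    by exists x, y.
  by exists x; rewrite xS; apply/existsP; exists y; rewrite yS xy E eqxx.
have QD : Q (b ^ D).
  have [x [y [xS yS xy]]] := card_gt1P S_gt1; apply/QP; exists x, y.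
  by rewrite !divn_small // (leq_trans (ltn_ord _) n_le).
(* The least shift merging two vertices is some [q.+1]: shifting by [q] still separates [S], and
   [q < b ^ D]. *)
case: (ex_minnP (ex_intro (fun q => Q q) _ QD)) => -[|q] /QP branch minq.
  by have [x [y [_ _ /eqP xy]]] := branch; rewrite !divn1 => /val_inj/xy.
apply: (clique_step Sp _ (minq _ QD) branch) => [x y xS yS E|T T0 ltTS].
  apply/eqP; apply: contraT => xy; suff /minq : Q q by rewrite ltnn.
  by apply/QP; exists x, y.
by apply: IHm T0 _; [apply: leq_trans ltTS _|apply: leq_trans (ltnW ltTS) Sp].
Qed.

End Clique.
End BlockColoring.

(** * Upper bound on the number of colours *)

Section CountValues.
Context (X : eqType) (s : seq X).

Lemma size_undup_pair (T1 T2 : eqType) (g : X -> T1) (h : X -> T2) :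
  size (undup [seq (g x, h x) | x <- s]) <= size (undup (map g s)) * size (undup (map h s)).
Proof.
rewrite -(size_allpairs (fun u v => (u, v))); apply: uniq_leq_size (undup_uniq _) _ => u.
rewrite mem_undup => /mapP[x xs ->]; apply/allpairsP; exists (g x, h x).
by split; rewrite /= ?mem_undup ?map_f.
Qed.

Lemma size_undup_bounded (g : X -> nat) M :
  (forall x, g x < M) -> size (undup (map g s)) <= M.
Proof.
move=> gM; rewrite -[leqRHS](size_iota 0); apply: uniq_leq_size (undup_uniq _) _ => u.
by rewrite mem_undup => /mapP[x _ ->]; rewrite mem_iota gM.
Qed.

Lemma size_undup_seq (I T : eqType) (g : I -> X -> T) K (r : seq I) :
    {in r, forall i, size (undup (map (g i) s)) <= K} ->
  size (undup [seq [seq g i x | i <- r] | x <- s]) <= K ^ size r.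
Proof.
elim: r => [_|i r IH gK] /=.
  rewrite -[leqRHS]/(size [:: [::] : seq T]); apply: uniq_leq_size (undup_uniq _) _ => u.
  by rewrite mem_undup => /mapP[x _ ->]; rewrite mem_head.
apply: leq_trans (size_undup_factor (fun x => (g i x, [seq g j x | j <- r]))
  (fun u => u.1 :: u.2) s) _.
apply: leq_trans (size_undup_pair _ _) _; rewrite expnS; apply: leq_mul.
  by apply: gK; rewrite mem_head.
by apply: IH => j jr; apply: gK; rewrite inE jr orbT.
Qed.

End CountValues.

(** [find] over [b.+1] candidates returns at most [b.+1], its value when none succeeds; hence the
    crude [b.+2]. *)
Lemma digit_diff_bounded b r U V :
  [/\ (digit_diff b r U V).1.1 < b.+2, (digit_diff b r U V).1.2 < 2 ^ r &
      (digit_diff b r U V).2 < 2 ^ r].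
Proof.
rewrite /digit_diff; case E: (find _ _) => [|k]; first by rewrite pow2_gt0.
split; try exact: block_lt.
by rewrite -E ltnS -[leqRHS](size_iota 0) find_size.
Qed.

Lemma ncolors_block_coloring m D n :
  ncolors (@block_coloring (2 ^ m) D n) [set: 'I_n] <=
  2 ^ ((m + 4) * (2 ^ m) ^ D.-1 * D).
Proof.
set b := 2 ^ m; rewrite /ncolors /colors_in; set s := enum _.
pose lo (e : 'I_n * 'I_n) : nat := minn e.1 e.2.
pose hi (e : 'I_n * 'I_n) : nat := maxn e.1 e.2.
apply: leq_trans (size_undup_factor (fun e => all_diffs b D (lo e) (hi e)) pickle s) _.
rewrite expnM; set K := 2 ^ _; rewrite -[X in K ^ X](size_iota 0 D); apply: size_undup_seq => d; rewrite {}/K.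
rewrite mem_iota => /andP[_ dD].
(* A record takes [m + 2] bits for the position and [b ^ d] for each digit, at most
   [(m + 4) * b ^ d] in all since [b ^ d] is positive. *)
have le_exp : (m + 2 + b ^ d + b ^ d) * b ^ (D - d.+1) <= (m + 4) * b ^ D.-1.
  have -> : D.-1 = d + (D - d.+1) by lia.
  rewrite expnD mulnA leq_mul2r; apply/orP; right.
  have : 0 < b ^ d by rewrite expn_gt0 pow2_gt0.
  by nia.
apply: leq_trans (leq_pexp2l _ le_exp) => //.
rewrite expnM; set K := 2 ^ _; rewrite -[X in K ^ X](size_iota 0); apply: size_undup_seq => P _.
rewrite {}/K.
pose L e := level_diff b d P (lo e) (hi e).
have bounded e : [/\ (L e).1.1 < b.+2, (L e).1.2 < 2 ^ (b ^ d) & (L e).2 < 2 ^ (b ^ d)].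
  exact: digit_diff_bounded.
rewrite (@eq_map _ _ _ (fun e => ((L e).1.1, (L e).1.2, (L e).2))); last first.
  by move=> e; rewrite /= -!surjective_pairing.
apply: leq_trans (size_undup_pair _ _ _) _; rewrite expnD; apply: leq_mul; last first.
  by apply: size_undup_bounded => e; case: (bounded e).
apply: leq_trans (size_undup_pair _ _ _) _; rewrite expnD; apply: leq_mul; last first.
  by apply: size_undup_bounded => e; case: (bounded e).
have b_le : b.+2 <= 2 ^ (m + 2).
  by rewrite expnD -/b -[2 ^ 2]/4; move: (pow2_gt0 m : 0 < b); lia.
by apply: leq_trans b_le; apply: size_undup_bounded => e; case: (bounded e).
Qed.

(** * Choice of the parameters and conclusion *)

Lemma block_exponent_ex D n : exists m, n <= 2 ^ ((2 ^ m) ^ D.+1).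
Proof.
exists n; apply: leq_trans (ltnW (ltn_expl n (isT : 1 < 2))) _; apply: leq_pexp2l => //.
apply: leq_trans (ltnW (ltn_expl n (isT : 1 < 2))) _.
by rewrite -{1}[2 ^ n]expn1 leq_pexp2l.
Qed.

(** The induction starts at 7 because at 6 the two sides are 66 and 64. *)
Lemma mul_add5_leq_pow2 m : 7 <= m -> (m + 5) * m <= 2 ^ m.
Proof.
elim: m => // m IH; rewrite ltnS leq_eqVlt => /predU1P[<-//|m7].
by move: (IH m7); rewrite expnS; nia.
Qed.

Theorem theorem1p1 (p : nat) (hp : 3 <= p) :
  exists chi : forall n : nat, edge_coloring n,
    (forall n, symmetric_coloring (chi n)) /\
    (* (i) number of colors is n^{o(1)}: for every k >= 1, eventually
           (#colors)^k <= n, i.e. #colors <= n^(1/k) *)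
    (forall k : nat, 0 < k -> exists N : nat, forall n : nat, N <= n ->
        ncolors (chi n) [set: 'I_n] ^ k <= n) /\
    (* (ii) (p, p-1)-coloring *)
    (forall n (S : {set 'I_n}), #|S| = p -> p.-1 <= ncolors (chi n) S) /\
    (* (iii) p-cliques with exactly p-1 colors have a leftover structure *)
    (forall n (S : {set 'I_n}), #|S| = p -> ncolors (chi n) S = p.-1 ->
        leftover (chi n) S).
Proof.
(* [D] has to exceed [p + p], the bound on the potential in [stable_level]. *)
pose D' := p + p; pose D := D'.+1.
have b_gt0 m : 0 < 2 ^ m := pow2_gt0 m.
pose chi n : edge_coloring n := @block_coloring (2 ^ ex_minn (block_exponent_ex D' n)) D n.
have bound n (S : {set 'I_n}) : #|S| = p ->
    #|S| <= (ncolors (chi n) S).+1 /\ (#|S| = (ncolors (chi n) S).+1 -> leftover (chi n) S).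
  move=> Sp; rewrite /chi; case: ex_minnP => m le_n _.
  apply: (clique_bound (b_gt0 m) le_n (ltnSn (p + p))); last by rewrite Sp.
  by rewrite -card_gt0 Sp; apply: leq_trans hp.
exists chi; split; first by move=> n x y; apply: block_codeC.
split; last first.
  split=> n S Sp; first by have [] := bound n S Sp; rewrite Sp -subn1 leq_subLR.
  by move=> col; have [_] := bound n S Sp; apply; rewrite Sp col prednK // (leq_trans _ hp).
(* [C] gathers the constants: if the chosen exponent is [m.+1], the [k]-th power of the colour count
   is at most 2 to the [(m + 5) * C * (2 ^ m) ^ D'], to be compared with [(2 ^ m) ^ D]. For this
   [C + 7 <= m] suffices, which the threshold on [n] ensures. *)
move=> k k_gt0; pose C := 2 ^ D' * D * k.
exists (2 ^ ((2 ^ (C + 7)) ^ D)).+1 => n n_gt.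
rewrite /chi; case: ex_minnP => m le_n minm.
have m_gt : C + 7 < m.
  rewrite ltnNge; apply/negP => le_m.
  have : n <= 2 ^ ((2 ^ (C + 7)) ^ D).
    by apply: leq_trans le_n _; rewrite leq_pexp2l // leq_exp2r // leq_pexp2l.
  by rewrite leqNgt n_gt.
case: m m_gt minm {le_n} => // m; rewrite ltnS => m_ge minm.
(* By minimality of the chosen exponent, strings built from [m] are too short for [n]. *)
have {minm} n_big : 2 ^ ((2 ^ m) ^ D) < n.
  by rewrite ltnNge; apply/negP => /minm; rewrite ltnn.
apply: leq_trans (ltnW n_big).
have := ncolors_block_coloring m.+1 D n; rewrite -(leq_exp2r _ _ k_gt0) -expnM.
move=> /leq_trans; apply; rewrite leq_pexp2l //.
have -> : (2 ^ m.+1) ^ D' = 2 ^ D' * (2 ^ m) ^ D' by rewrite -expnMn -expnS.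
have -> : (m.+1 + 4) * (2 ^ D' * (2 ^ m) ^ D') * D * k = (m + 5) * C * (2 ^ m) ^ D'.
  by rewrite /C /D; move: ((2 ^ m) ^ D') (2 ^ D') D'.+1 => u v w; nia.
rewrite expnS leq_mul2r; apply/orP; right.
apply: leq_trans (mul_add5_leq_pow2 _); first by rewrite leq_mul2l; apply/orP; right; lia.
by lia.
Qed.
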